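(* Let $\lambda\in\mathbb{R}$, let $r$ be a nonnegative integer, and let $k\geq 0$ be an integer. Then $$\frac{1}{(x+r)(x+r+\lambda)\cdots(x+r+k\lambda)}=\sum_{n=k}^{\infty}(-1)^{n-k}{n+r \brace k+r}_{r,\lambda}\Big(\frac{1}{x}\Big)^{n+1},$$ where the right-hand side is the expansion of the left-hand side in powers of $1/x$.
   Context: For $\lambda\in\mathbb{R}$, $(x)_{0,\lambda}=1$ and $(x)_{n,\lambda}=x(x-\lambda)\cdots(x-(n-1)\lambda)$ for $n\ge1$. For a nonnegative integer $r$, the $\lambda$-analogues of $r$-Stirling numbers of the second kind ${n+r \brace k+r}_{r,\lambda}$ ($0\le k\le n$) are defined by $(x+r)^n=\sum_{k=0}^n{n+r \brace k+r}_{r,\lambda}(x)_{k,\lambda}$ for $n\ge0$; they are set to $0$ for $k>n$. *)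

(* Defs.v *)
From HB Require Import structures.
From mathcomp Require Import all_boot all_order all_algebra.
From mathcomp Require Import complex ring.
From mathcomp Require Import all_classical all_reals all_analysis.
Set Implicit Arguments.
Unset Strict Implicit.
Unset Printing Implicit Defensive.
Import Order.TTheory GRing.Theory Num.Theory.
Local Open Scope ring_scope.

(* R[i] at its numFieldType structure: this is the key under which
   MathComp-Analysis provides the topology induced by the modulus. *)
Definition Cplx (R : realType) : numFieldType := R[i]%C.

Definition toC (R : realType) (a : R) : Cplx R := a%:C%C.

(* lffact lambda x n is written (x)_{n,lambda}. *)
Definition lffact (R : pzRingType) (lambda x : R) (n : nat) : R :=
  \prod_(i < n) (x - i%:R * lambda).

(* S n k stands for {n+r brace k+r}_{r,lambda}: the shift of both indices by r
   is left implicit. *)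
Definition rStirling2_spec (R : realType) (lambda : R) (r : nat)
    (S : nat -> nat -> R) : Prop :=
  (forall (n : nat) (x : R),
     (x + r%:R) ^+ n = \sum_(k < n.+1) S n k * lffact lambda x k) /\
  (forall n k : nat, (n < k)%N -> S n k = 0).

Lemma rStirling2_exists (R : realType) (lambda : R) (r : nat) :
  exists S : nat -> nat -> R, rStirling2_spec lambda r S.
Proof.
pose step (s : nat -> R) (k : nat) : R :=
  (if k is j.+1 then s j else 0) + (r%:R + k%:R * lambda) * s k.
pose S := fix S n := if n is m.+1 then step (S m) else fun k => (k == 0%N)%:R.
have S0 n k : (n < k)%N -> S n k = 0.
  elim: n k => [|n IH] [|k] //= lt_nk.
  by rewrite /step !IH ?mulr0 ?addr0 // ltnW.
exists S; split=> // n x; elim: n => [|n IH].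
  by rewrite big_ord1 /lffact big_ord0 expr0 mulr1.
have lffactS k : lffact lambda x k.+1 = lffact lambda x k * (x - k%:R * lambda).
  by rewrite /lffact big_ord_recr.
rewrite exprSr {}IH mulr_suml.
transitivity (\sum_(k < n.+1) (S n k * lffact lambda x k.+1 +
    (r%:R + k%:R * lambda) * S n k * lffact lambda x k)).
  by apply: eq_bigr => k _; rewrite lffactS; ring.
rewrite big_split /=.
transitivity (\sum_(k < n.+2) ((if k : nat is j.+1 then S n j else 0) *
      lffact lambda x k +
    (r%:R + k%:R * lambda) * S n k * lffact lambda x k)); last first.
  by apply: eq_bigr => k _; rewrite -mulrDl.
rewrite [RHS]big_split /= [X in _ = X + _]big_ord_recl mul0r add0r.
by rewrite [X in _ = _ + X]big_ord_recr /= S0 // mulr0 mul0r addr0.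
Qed.

Lemma rStirling2_unique (R : realType) (lambda : R) (r : nat)
    (S T : nat -> nat -> R) :
  rStirling2_spec lambda r S -> rStirling2_spec lambda r T -> S =2 T.
Proof.
move=> [Seq S0] [Teq T0] n k.
case: (ltnP n k) => [lt_nk|]; first by rewrite S0 ?T0.
rewrite -ltnS => lt_kn; apply/eqP; rewrite -subr_eq0; apply/eqP.
pose p j : {poly R} := \prod_(i < j) ('X - (i%:R * lambda)%:P).
have size_p j : size (p j) = j.+1.
  by rewrite /p size_prod_XsubC /index_enum -enumT size_enum_ord.
have lead_p j : (p j)`_j = 1.
  by have /monicP := monic_prod_XsubC (index_enum 'I_j) xpredT
       (fun i : 'I_j => i%:R * lambda); rewrite lead_coefE size_p.
pose d j := S n j - T n j.
have : \sum_(j < n.+1) d j *: p j = 0.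
  apply/eqP; apply/negPn/negP => nz.
  set q := \sum_(j < _) _ in nz.
  have := @max_poly_roots _ q [seq i%:R | i <- iota 0 (size q)] nz.
  rewrite size_map size_iota ltnn map_inj_uniq ?iota_uniq; last first.
    by move=> a b /eqP; rewrite eqr_nat => /eqP.
  suff -> : all (root q) [seq i%:R | i <- iota 0 (size q)] by move=> /(_ erefl erefl).
  apply/allP => x _; apply/rootP; rewrite horner_sum.
  transitivity (\sum_(j < n.+1) (S n j * lffact lambda x j
                                 - T n j * lffact lambda x j)).
    apply: eq_bigr => j _; rewrite hornerZ horner_prod /d mulrBl /lffact.
    by under eq_bigr do rewrite hornerXsubC.
  by rewrite sumrB -Seq -Teq subrr.
move: (n.+1) lt_kn => m; rewrite -/(d k).
elim: m => // m IH lt_km sum0.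
have dm0 : d m = 0.
  have := congr1 (fun q : {poly R} => q`_m) sum0.
  rewrite big_ord_recr /= coefD coefZ lead_p mulr1 coef_sum coef0.
  rewrite big1 ?add0r // => i _.
  by rewrite coefZ nth_default ?mulr0 // size_p.
move: lt_km; rewrite ltnS leq_eqVlt => /predU1P[-> //|lt_km].
by apply: IH => //; move: sum0; rewrite big_ord_recr /= dm0 scale0r addr0.
Qed.

Definition rStirling2 (R : realType) (lambda : R) (r : nat) :
    nat -> nat -> R :=
  sval (cid (rStirling2_exists lambda r)).

Lemma rStirling2P (R : realType) (lambda : R) (r : nat) :
  rStirling2_spec lambda r (rStirling2 lambda r).
Proof. exact: svalP (cid (rStirling2_exists lambda r)). Qed.

(* Main.v *)
(* Put y = 1/x and a_i = r + i lambda. The partial sums G_k(N) of the series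
   for k obey, by the triangular recurrence of the Stirling numbers,
   G_k(N+1) = - y a_k G_k(N) + y G_(k-1)(N), with y in place of the last term
   when k = 0. As |y a_k| < 1, such an affine recursion forces G_k(N) to
   converge to y g_(k-1) / (1 + y a_k) = g_(k-1) / (x + a_k), g_(k-1) being the
   limit of G_(k-1), and induction on k concludes. *)
Require Import Defs.
From HB Require Import structures.
From mathcomp Require Import all_boot all_order all_algebra.
From mathcomp Require Import complex ring.
From mathcomp Require Import all_classical all_reals all_analysis.
Import Order.TTheory GRing.Theory Num.Theory.
Import numFieldNormedType.Exports.
Local Open Scope classical_set_scope.
Local Open Scope ring_scope.

Lemma rStirling2_0 (R : realType) (lambda : R) (r k : nat) :
  rStirling2 lambda r 0 k = (k == 0%N)%:R.
Proof.
have [Seq S0] := rStirling2P lambda r; case: k => [|k]; last by rewrite S0.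
by have := Seq 0%N 0; rewrite big_ord1 /lffact big_ord0 expr0 mulr1.
Qed.

(** Writing [x + r] as [(x - k lambda) + (r + k lambda)] turns multiplication of [(x)_{k,lambda}] by
    [x + r] into a combination of [(x)_{k+1,lambda}] and [(x)_{k,lambda}]; uniqueness of the
    coefficients does the rest. *)
Lemma rStirling2_rec (R : realType) (lambda : R) (r n k : nat) :
  rStirling2 lambda r n.+1 k =
    (if k is j.+1 then rStirling2 lambda r n j else 0) +
    (r%:R + k%:R * lambda) * rStirling2 lambda r n k.
Proof.
have [] := rStirling2P lambda r; set S := rStirling2 lambda r => Seq S0.
pose step (s : nat -> R) (k : nat) : R :=
  (if k is j.+1 then s j else 0) + (r%:R + k%:R * lambda) * s k.
(* Each later row of [T] is one step applied to a row of [S] itself, so the specification of [T]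
   follows from that of [S] without induction. *)
pose T m := if m is m'.+1 then step (S m') else S 0%N.
rewrite -[RHS]/(T n.+1 k); apply: (@rStirling2_unique _ lambda r) => //.
split=> [[|m] x|m j ltmj]; first exact: Seq 0%N x; last first.
  case: m j ltmj => [|m] [|j] // ltmj; first exact: (S0 0%N).
  by rewrite /T /step !S0 ?mulr0 ?addr0 // ltnW.
rewrite exprSr Seq mulr_suml.
transitivity (\sum_(j < m.+1) (S m j * lffact lambda x j.+1 +
    (r%:R + j%:R * lambda) * S m j * lffact lambda x j)).
  apply: eq_bigr => j _; rewrite /lffact big_ord_recr /=; ring.
rewrite big_split /=.
under [RHS]eq_bigr do rewrite /step mulrDl.
rewrite [RHS]big_split /= [X in _ = X + _]big_ord_recl mul0r add0r.
by rewrite [X in _ = _ + X]big_ord_recr /= S0 // mulr0 mul0r addr0.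
Qed.

(** The limit is the fixed point of [t -> c * t + l]; the distance to it shrinks by [|c|] at each
    step, up to the error [l - v n]. Decay of [c ^+ n] is assumed separately since [K] need not be
    archimedean. *)
Lemma cvg_affine_rec {K : numFieldType} (c l : K) (u v : nat -> K) :
  `|c| < 1 -> (fun n => c ^+ n) @ \oo --> (0 : K) ->
  (forall n, u n.+1 = c * u n + v n) ->
  v @ \oo --> l -> u @ \oo --> l / (1 - c).
Proof.
move=> c1 cvc urec cvv; set L := l / (1 - c).
have c1_gt0 : 0 < 1 - `|c| by rewrite subr_gt0.
have cn1 : 1 - c != 0.
  by rewrite subr_eq0; apply: contraTneq c1 => <-; rewrite normr1 ltxx.
apply/cvgrPdist_le => e e0.
have e20 : 0 < e / 2 by rewrite divr_gt0.
(* With this tolerance, [e / 2] is the fixed point of [t -> |c| * t + e / 2 * (1 - |c|)], so the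
   accumulated errors never exceed [e / 2]. *)
move/cvgrPdist_le: cvv => /(_ (e / 2 * (1 - `|c|)) (mulr_gt0 e20 c1_gt0)).
case=> M _ HM.
have bnd m : `|L - u (M + m)%N| <= `|c ^+ m| * `|L - u M| + e / 2.
  elim: m => [|m IH]; first by rewrite addn0 expr0 normr1 mul1r lerDl ltW.
  have -> : L - u (M + m.+1)%N =
      c * (L - u (M + m)%N) + (l - v (M + m)%N).
    by rewrite addnS urec /L; field.
  apply: (le_trans (ler_normD _ _)); rewrite normrM.
  have -> : `|c ^+ m.+1| * `|L - u M| + e / 2 =
     `|c| * (`|c ^+ m| * `|L - u M| + e / 2) + e / 2 * (1 - `|c|).
    by rewrite exprS normrM; ring.
  by apply: lerD; [exact: ler_wpM2l | apply: HM; rewrite /= leq_addr].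
(* The [+ 1] keeps the denominator positive when [u M = L]. *)
have d0 : 0 < e / 2 / (`|L - u M| + 1).
  by rewrite divr_gt0 // ltr_wpDl.
move/cvgrPdist_le: cvc => /(_ _ d0) [M' _ HM'].
exists (M + M')%N => // n /= le_n.
have -> : n = (M + (n - M))%N by rewrite subnKC // (leq_trans _ le_n) ?leq_addr.
apply: (le_trans (bnd _)); rewrite [leRHS]splitr lerD2r.
have : (M' <= n - M)%N by rewrite leq_subRL // (leq_trans _ le_n) ?leq_addr.
move=> /HM'; rewrite sub0r normrN => H.
have nz : 0 < `|L - u M| + 1 by rewrite ltr_wpDl.
rewrite ler_pdivlMr // in H; apply: le_trans H.
by apply: ler_wpM2l => //; rewrite lerDl.
Qed.

Lemma cvg_expr_Cplx (R : realType) (c : Cplx R) :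
  `|c| < 1 -> (fun n => c ^+ n) @ \oo --> (0 : Cplx R).
Proof.
pose rho : R := Num.sqrt (complex.Re c ^+ 2 + complex.Im c ^+ 2).
have cE : `|c| = toC rho :> Cplx R by exact: normc_def.
have rho0 : 0 <= rho by exact: sqrtr_ge0.
rewrite cE -[1]/(toC (1 : R)) -[_ < _]/(rho%:C%C < 1%:C%C) ltcR => rho1.
apply/cvgrPdist_lt => e; case: e => e1 e2.
(* Positivity in the order of the complex numbers forces [e] to be real, which reduces the claim to
   the real geometric sequence of ratio [rho]. *)
rewrite /= ltcE /= => /andP[/eqP -> e0].
have : geometric 1 rho @ \oo --> (0 : R).
  by apply: cvg_geometric; rewrite ger0_norm.
move/cvgrPdist_lt => /(_ _ e0) [M _ HM]; exists M => // n /HM /=.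
rewrite !sub0r !normrN mul1r ger0_norm ?exprn_ge0 // normrX => ltn; rewrite cE.
by rewrite -(rmorphXn (real_complex R)) -[_ < _]/(_ < e1%:C%C :> R[i]) ltcR.
Qed.

Theorem theorem8 (R : realType) (lambda : R) (r k : nat) (x : Cplx R)
    (hx : forall i : nat, (i <= k)%N ->
            `|toC (r%:R + i%:R * lambda)| < `|x|) :
  (fun N : nat => \sum_(k <= n < N)
     (-1) ^+ (n - k) * toC (rStirling2 lambda r n k) * (1 / x) ^+ n.+1)
    @ \oo -->
  1 / \prod_(i < k.+1) (x + r%:R + i%:R * toC lambda).
Proof.
pose S n k := toC (rStirling2 lambda r n k).
(* Starting at [0] with sign exponent [n + k] avoids truncated subtraction and makes the recurrence
   in [N] hold for all indices. *)
pose G k N := \sum_(0 <= n < N) (-1) ^+ (n + k) * S n k * (1 / x) ^+ n.+1.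
pose a i := toC (r%:R + i%:R * lambda).
have aE i : a i = r%:R + i%:R * toC lambda.
  by rewrite /a /toC -[_%:C%C]/(real_complex R _) rmorphD rmorphM !rmorph_nat.
have x0 : x != 0.
  by rewrite -normr_gt0; apply: le_lt_trans (hx 0%N _).
have SS n j : S n.+1 j = (if j is j'.+1 then S n j' else 0) + a j * S n j.
  rewrite /S /a /toC rStirling2_rec -[_%:C%C]/(real_complex R _) rmorphD rmorphM.
  by case: j => [|j]; rewrite ?rmorph0.
have S0 j : S 0%N j = (j == 0%N)%:R.
  by rewrite /S /toC rStirling2_0 -[_%:C%C]/(real_complex R _) rmorph_nat.
have GS j N : G j N.+1 = - (a j / x) * G j N +
    (if j is j'.+1 then G j' N / x else 1 / x).
  (* The term [n = 0], split off here, survives only for [j = 0], where it is [1 / x]. *)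
  rewrite /G big_nat_recl // add0n S0.
  under eq_bigr do rewrite SS.
  case: j => [|j].
    rewrite /= expr0 !mul1r expr1 addrC; congr (_ + _).
    by rewrite mulr_sumr; apply: eq_bigr => n _; rewrite addSn !exprS; ring.
  rewrite /= mulr0 mul0r add0r mulr_sumr mulr_suml -big_split /=.
  apply: eq_bigr => n _; rewrite addSn addnS !exprS; ring.
have cvgG j : (j <= k)%N -> G j @ \oo -->
    1 / \prod_(i < j.+1) (x + r%:R + i%:R * toC lambda).
  have step (i : nat) (v : nat -> Cplx R) (l : Cplx R) : (i <= k)%N ->
      (forall N, G i N.+1 = - (a i / x) * G i N + v N / x) ->
      v @ \oo --> l -> G i @ \oo --> l / (x + a i).
    move=> leik rec cvv.
    have -> : l / (x + a i) = (l / x) / (1 - - (a i / x)).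
      by rewrite opprK -[l / x / _]mulrA -invfM mulrDr mulr1 [x * _]mulrC divfK.
    have c1 : `|- (a i / x)| < 1.
      by rewrite normrN normf_div ltr_pdivrMr ?normr_gt0 // mul1r; exact: hx.
    apply: (@cvg_affine_rec (Cplx R) (- (a i / x)) (l / x) _ _ c1 _ rec).
      exact: cvg_expr_Cplx c1.
    by apply: cvgM cvv _; exact: cvg_cst.
  elim: j => [|j IH] lejk.
    (* The constant sequence [1] stands in for the missing predecessor of [G 0]. *)
    rewrite big_ord1 -addrA -aE; apply: (step 0%N (fun=> 1)) => //.
    exact: cvg_cst.
  have -> : 1 / \prod_(i < j.+2) (x + r%:R + i%:R * toC lambda) =
    1 / \prod_(i < j.+1) (x + r%:R + i%:R * toC lambda) / (x + a j.+1).
    by rewrite big_ord_recr /= !div1r invfM aE addrA.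
  by apply: step (IH (ltnW lejk)).
(* Once [N >= k], [G k N] is the stated partial sum: terms with [n < k] vanish, and [n + k] and
   [n - k] have the same parity. *)
apply: cvg_trans (cvgG k (leqnn k)); apply: near_eq_cvg.
exists k => // N /= leN; rewrite /G (big_cat_nat _ leN) //= big_nat big1 ?add0r.
  rewrite big_nat [RHS]big_nat; apply: eq_bigr => n /andP[lekn _].
  rewrite -[in (n + k)%N](subnK lekn) -addnA addnn exprD -mul2n exprM sqrrN.
  by rewrite !expr1n mulr1.
move=> n ltnk; have [_ Sz] := rStirling2P lambda r.
by rewrite /S Sz // /toC -[_%:C%C]/(real_complex R _) rmorph0 mulr0 mul0r.
Qed.
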